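(* Let $w_1,\dots,w_N\in\mathbb{C}$ be an arbitrary set of complex constants, and let $A_j=A_j(\xi,\bar\xi)\in gl(2,\mathbb{C})$, $j=1,\dots,N$. (1) If $\gamma_j=\gamma(w_j;\xi,\bar\xi)$ for $j=1,\dots,N$, then the two matrix differential equations $$\frac{\partial A_j}{\partial\xi}=\frac{2}{\xi-\bar\xi}\sum_{k\neq j}\frac{[A_k,A_j]}{(1-\gamma_k)(1-\gamma_j)},\qquad \frac{\partial A_j}{\partial\bar\xi}=\frac{2}{\bar\xi-\xi}\sum_{k\neq j}\frac{[A_k,A_j]}{(1+\gamma_k)(1+\gamma_j)}\qquad(j=1,\dots,N)$$ are compatible. (2) If $\{A_j(\xi,\bar\xi)\}$ is an arbitrary solution of these equations (with $\gamma_j=\gamma(w_j;\xi,\bar\xi)$), then the linear system $$g_\xi g^{-1}=\frac{2}{\xi-\bar\xi}\sum_{j=1}^N\frac{A_j}{1-\gamma_j},\qquad g_{\bar\xi}g^{-1}=\frac{2}{\bar\xi-\xi}\sum_{j=1}^N\frac{A_j}{1+\gamma_j}$$ for $g(\xi,\bar\xi)$ is also compatible, and its solution $g(\xi,\bar\xi)\in GL(2,\mathbb{C})$ satisfies the (complexified) Ernst equation $$\big((\xi-\bar\xi)g_\xi g^{-1}\big)_{\bar\xi}+\big((\xi-\bar\xi)g_{\bar\xi}g^{-1}\big)_\xi=0 .$$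
   Context: Coordinates: $\xi=x+i\rho$, $\bar\xi=x-i\rho$ with $x\in\mathbb{R}$, $\rho>0$; subscripts $\xi,\bar\xi$ denote partial derivatives. For a constant $w\in\mathbb{C}$, $$\gamma(w;\xi,\bar\xi)=\frac{2}{\xi-\bar\xi}\Big\{w-\frac{\xi+\bar\xi}{2}+\sqrt{(w-\xi)(w-\bar\xi)}\Big\}$$ (a fixed local branch of the square root, away from $w=\xi$ and $w=\bar\xi$), which satisfies $$\gamma_\xi=\frac{\gamma}{\xi-\bar\xi}\,\frac{1+\gamma}{1-\gamma},\qquad \gamma_{\bar\xi}=\frac{\gamma}{\bar\xi-\xi}\,\frac{1-\gamma}{1+\gamma}.$$ ''Compatible'' means that the integrability condition $\partial_\xi\partial_{\bar\xi}=\partial_{\bar\xi}\partial_\xi$ for the unknowns ($A_j$, respectively $g$) is identically satisfied as a consequence of the equations themselves, on the local domain where all $\gamma_j$ are smooth. $[\cdot,\cdot]$ is the matrix commutator. *)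

(* Defs.v *)
From HB Require Import structures.
From mathcomp Require Import all_boot all_order all_algebra.
From mathcomp Require Import all_classical all_reals all_analysis.
From mathcomp Require Export complex.
Import Order.TTheory GRing.Theory Num.Theory.
Import numFieldNormedType.Exports.

Set Implicit Arguments.
Unset Strict Implicit.
Unset Printing Implicit Defensive.

Local Open Scope classical_set_scope.
Local Open Scope ring_scope.
Local Open Scope complex_scope.

Section Wirtinger.
Context {R : realType}.
Implicit Types (p v : R * R) (f : R * R -> R[i]) (M : R * R -> 'M[R[i]]_2).

(* Points are pairs p = (x, rho). *)
Definition xi p : R[i] := p.1 +i* p.2.
Definition xibar p : R[i] := p.1 -i* p.2.

(* R[i] carries no normed-module structure over R, so real continuity and
   differentiability are expressed through real and imaginary parts. *)
Definition ccontinuous_at f p : Prop :=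
  {for p, continuous (fun q => complex.Re (f q))} /\
  {for p, continuous (fun q => complex.Im (f q))}.

Definition cdifferentiable f p : Prop :=
  differentiable (fun q => complex.Re (f q)) p /\
  differentiable (fun q => complex.Im (f q)) p.

Definition cderive f v p : R[i] :=
  'D_v (fun q => complex.Re (f q)) p +i* 'D_v (fun q => complex.Im (f q)) p.

(* xi = x + i rho and xibar = x - i rho give
   d/dxi = (d/dx - i d/drho) / 2 and d/dxibar = (d/dx + i d/drho) / 2. *)
Definition dxi f p : R[i] :=
  (cderive f (1, 0) p - (0 +i* 1) * cderive f (0, 1) p) / 2.
Definition dxibar f p : R[i] :=
  (cderive f (1, 0) p + (0 +i* 1) * cderive f (0, 1) p) / 2.

Definition mdifferentiable M p : Prop :=
  forall a b, cdifferentiable (fun q => M q a b) p.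
Definition mdxi M p : 'M[R[i]]_2 :=
  \matrix_(a, b) dxi (fun q => M q a b) p.
Definition mdxibar M p : 'M[R[i]]_2 :=
  \matrix_(a, b) dxibar (fun q => M q a b) p.

End Wirtinger.

Section ErnstDeformation.
Context {R : realType}.
Implicit Types (D : set (R * R)) (p q : R * R) (s : R * R -> R[i]).

Definition sqrt_branch (w : R[i]) D s : Prop :=
  forall p, D p ->
    [/\ w <> xi p, w <> xibar p, ccontinuous_at s p &
        s p ^+ 2 = (w - xi p) * (w - xibar p)].

(* gamma (w; xi, xibar), with s the chosen branch of the square root. *)
Definition gamma (w : R[i]) s p : R[i] :=
  2 / (xi p - xibar p) * (w - (xi p + xibar p) / 2 + s p).

Definition mxcomm (A B : 'M[R[i]]_2) : 'M[R[i]]_2 := A *m B - B *m A.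

Section Systems.
Context {N : nat}.
Implicit Types (gam : 'I_N -> R * R -> R[i]) (A : 'I_N -> R * R -> 'M[R[i]]_2).

(* Right-hand sides as functions of the point p and of the values
   a j = A_j(p) of the unknowns. *)
Definition deform_xi gam (j : 'I_N) p (a : 'I_N -> 'M[R[i]]_2) : 'M[R[i]]_2 :=
  (2 / (xi p - xibar p)) *:
    \sum_(k < N | k != j)
      ((1 - gam k p) * (1 - gam j p))^-1 *: mxcomm (a k) (a j).
Definition deform_xibar gam (j : 'I_N) p (a : 'I_N -> 'M[R[i]]_2) :
    'M[R[i]]_2 :=
  (2 / (xibar p - xi p)) *:
    \sum_(k < N | k != j)
      ((1 + gam k p) * (1 + gam j p))^-1 *: mxcomm (a k) (a j).

Definition deform_eq_at gam A p : Prop :=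
  forall j, [/\ mdifferentiable (A j) p,
    mdxi (A j) p = deform_xi gam j p (A ^~ p) &
    mdxibar (A j) p = deform_xibar gam j p (A ^~ p)].

Definition deform_solution D gam A : Prop :=
  forall p, D p -> deform_eq_at gam A p.

(* Integrability condition: the mixed derivatives, computed by differentiating
   the right-hand sides and eliminating first derivatives of the unknowns by
   means of the equations, agree identically in p and in the values A_j(p).
   The equations are imposed on A at the single point p only: A ranges over
   arbitrary local extensions of the 1-jet they prescribe at p, so the values
   A_j(p) are unrestricted.  For a solution on a neighbourhood of p the
   equality would merely be the symmetry of its second derivatives. *)
Definition deform_compatible D gam : Prop :=
  forall p A, D p -> deform_eq_at gam A p ->
  forall j,
    [/\ mdifferentiable (fun q => deform_xi gam j q (A ^~ q)) p,
        mdifferentiable (fun q => deform_xibar gam j q (A ^~ q)) p &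
        mdxibar (fun q => deform_xi gam j q (A ^~ q)) p =
        mdxi (fun q => deform_xibar gam j q (A ^~ q)) p].

Definition conn_xi gam A p : 'M[R[i]]_2 :=
  (2 / (xi p - xibar p)) *: \sum_(j < N) (1 - gam j p)^-1 *: A j p.
Definition conn_xibar gam A p : 'M[R[i]]_2 :=
  (2 / (xibar p - xi p)) *: \sum_(j < N) (1 + gam j p)^-1 *: A j p.

End Systems.

Section LinearSystem.
Implicit Types (U V g : R * R -> 'M[R[i]]_2).

Definition linear_eq_at U V g p : Prop :=
  [/\ g p \in unitmx, mdifferentiable g p,
      mdxi g p *m invmx (g p) = U p &
      mdxibar g p *m invmx (g p) = V p].

Definition linear_solution D U V g : Prop :=
  forall p, D p -> linear_eq_at U V g p.

(* As for deform_compatible, the value g p is an arbitrary element of GL(2). *)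
Definition linear_compatible D U V : Prop :=
  forall p g, D p -> linear_eq_at U V g p ->
    [/\ mdifferentiable (fun q => U q *m g q) p,
        mdifferentiable (fun q => V q *m g q) p &
        mdxibar (fun q => U q *m g q) p = mdxi (fun q => V q *m g q) p].

Definition ernst_xi g p : 'M[R[i]]_2 :=
  (xi p - xibar p) *: (mdxi g p *m invmx (g p)).
Definition ernst_xibar g p : 'M[R[i]]_2 :=
  (xi p - xibar p) *: (mdxibar g p *m invmx (g p)).

Definition ernst_equation D g : Prop :=
  forall p, D p ->
    [/\ mdifferentiable (ernst_xi g) p,
        mdifferentiable (ernst_xibar g) p &
        mdxibar (ernst_xi g) p + mdxi (ernst_xibar g) p = 0].

End LinearSystem.
End ErnstDeformation.

(* Main.v *)
Require Import Defs.
From mathcomp Require Import all_boot all_order all_algebra.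
From mathcomp Require Import all_classical all_reals all_analysis.
From mathcomp Require Import ring.
Import numFieldNormedType.Exports.
Import Order.TTheory GRing.Theory Num.Theory.

(* Put [t = xi - xibar], [u_j = 1 / (1 - gamma_j)], [v_j = 1 / (1 + gamma_j)],
   [U = 2 / t * sum_j u_j A_j] and [V = - 2 / t * sum_j v_j A_j].  The
   deformation equations read [d_xi A_j = u_j [U, A_j]] and
   [d_xibar A_j = v_j [V, A_j]].  Since [2 u_j v_j = u_j + v_j] and
   [d_xibar u_j = d_xi v_j = - (u_j - v_j) / (2 t)], they imply
     d_xibar U = (U - V) / (2 t) + [V, U] / 2,
     d_xi    V = (U - V) / (2 t) + [U, V] / 2.
   The difference of these is the zero-curvature condition for [g], their sum is
   the Ernst equation, and with the Jacobi identity they give the compatibility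
   of the equations for the [A_j].  All of this is pointwise, once the square
   roots, only assumed continuous, are known to be differentiable. *)

Set Implicit Arguments.
Unset Strict Implicit.
Unset Printing Implicit Defensive.

Local Open Scope classical_set_scope.
Local Open Scope ring_scope.
Local Open Scope complex_scope.

(** The first-order expansion of [f] at [x] depends only on the germ, so it is also one for [g].
    Uniqueness of the differential gives ['d g x = 'd f x], and continuity of the latter is
    known. *)
Lemma near_eq_differentiable (K : numFieldType) (V W : normedModType K)
    (f g : V -> W) (x : V) :
  (\near x, f x = g x) -> differentiable f x -> differentiable g x.
Proof.
move=> fg df; have [dfc dfE] := (diff_locallyP x f).1 df.
have dgE : g \o shift x = cst (g x) + 'd f x +o_ 0 id.
  apply/eqaddoP => e e0; have /eqaddoP/(_ e e0) := dfE.
  apply: filter_app.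
  have : \forall y \near 0, f (y + x) = g (y + x).
    have := fg; rewrite (near_shift 0 x).
    by apply: filterS => y; rewrite /= subr0.
  apply: filterS => y /= fgy.
  by rewrite !fctE/= fgy (nbhs_singleton fg).
have dE := diff_unique dfc dgE.
by apply/diff_locallyP; rewrite dE.
Qed.

(** * Calculus of complex-valued functions through real and imaginary parts *)

Section ComplexDifferential.
Context {R : realType}.
Implicit Types (f g : R * R -> R[i]) (p v : R * R).

Lemma complex_ReD (a b : R[i]) :
  complex.Re (a + b) = complex.Re a + complex.Re b.
Proof. by case: a b => [? ?] [? ?]. Qed.
Lemma complex_ImD (a b : R[i]) :
  complex.Im (a + b) = complex.Im a + complex.Im b.
Proof. by case: a b => [? ?] [? ?]. Qed.
Lemma complex_ReM (a b : R[i]) : complex.Re (a * b) =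
  complex.Re a * complex.Re b - complex.Im a * complex.Im b.
Proof. by case: a b => [? ?] [? ?]. Qed.
Lemma complex_ImM (a b : R[i]) : complex.Im (a * b) =
  complex.Re a * complex.Im b + complex.Im a * complex.Re b.
Proof. by case: a b => [? ?] [? ?]. Qed.
Lemma complex_ReV (a : R[i]) : complex.Re a^-1 =
  complex.Re a * (complex.Re a ^+ 2 + complex.Im a ^+ 2)^-1.
Proof. by case: a. Qed.
Lemma complex_ImV (a : R[i]) : complex.Im a^-1 =
  - (complex.Im a * (complex.Re a ^+ 2 + complex.Im a ^+ 2)^-1).
Proof. by case: a. Qed.

Lemma sqr_normc_gt0 (a : R[i]) :
  a != 0 -> 0 < complex.Re a ^+ 2 + complex.Im a ^+ 2.
Proof.
case: a => a b; rewrite eq_complex /= lt0r addr_ge0 ?sqr_ge0// andbT.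
by rewrite paddr_eq0 ?sqr_ge0// !sqrf_eq0.
Qed.

Lemma cdifferentiable_continuous f p :
  cdifferentiable f p -> ccontinuous_at f p.
Proof. by case=> df1 df2; split; exact: differentiable_continuous. Qed.

Lemma near_eq_cdifferentiable f g p : (\near p, f p = g p) ->
  cdifferentiable f p -> cdifferentiable g p.
Proof.
by move=> fg [df1 df2]; split; [move: df1|move: df2];
  apply: near_eq_differentiable; apply: filterS fg => q ->.
Qed.

Lemma near_eq_cderive f g v p : (\near p, f p = g p) ->
  cderive f v p = cderive g v p.
Proof.
by move=> fg; congr Complex; apply: near_eq_derive; apply: filterS fg => q ->.
Qed.

Lemma cdifferentiable_cst c p : cdifferentiable (fun=> c) p.
Proof. by split; exact: differentiable_cst. Qed.

Lemma cderive_cst c v p : cderive (fun=> c) v p = 0.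
Proof. by rewrite /cderive !derive_cst. Qed.

Lemma cdifferentiableD f g p : cdifferentiable f p -> cdifferentiable g p ->
  cdifferentiable (fun q => f q + g q) p.
Proof.
move=> [df1 df2] [dg1 dg2]; split.
  under eq_fun do rewrite complex_ReD; exact: differentiableD.
under eq_fun do rewrite complex_ImD; exact: differentiableD.
Qed.

Lemma cderiveD f g v p : cdifferentiable f p -> cdifferentiable g p ->
  cderive (fun q => f q + g q) v p = cderive f v p + cderive g v p.
Proof.
move=> [df1 df2] [dg1 dg2]; rewrite /cderive.
under eq_fun do rewrite complex_ReD.
under [X in _ +i* 'D_v X p]eq_fun do rewrite complex_ImD.
by rewrite !deriveD//; exact: diff_derivable.
Qed.

Lemma cdifferentiableM f g p : cdifferentiable f p -> cdifferentiable g p ->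
  cdifferentiable (fun q => f q * g q) p.
Proof.
move=> [df1 df2] [dg1 dg2]; split.
  under eq_fun do rewrite complex_ReM.
  by apply: differentiableB; exact: differentiableM.
under eq_fun do rewrite complex_ImM.
by apply: differentiableD; exact: differentiableM.
Qed.

Lemma cderiveM f g v p : cdifferentiable f p -> cdifferentiable g p ->
  cderive (fun q => f q * g q) v p = cderive f v p * g p + f p * cderive g v p.
Proof.
move=> [df1 df2] [dg1 dg2]; rewrite /cderive.
under eq_fun do rewrite complex_ReM.
under [X in _ +i* 'D_v X p]eq_fun do rewrite complex_ImM.
have D h : differentiable h p -> derivable h p v by exact: diff_derivable.
rewrite deriveB; [|by apply: derivableM; exact: D..].
rewrite deriveD; [|by apply: derivableM; exact: D..].
rewrite !deriveM; [|exact: D..].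
(* With the derivatives abstracted, [f p] and [g p] can be split into components and a polynomial
   identity remains. *)
move: ('D_v (fun q => complex.Re (f q)) p) ('D_v (fun q => complex.Im (f q)) p)
  ('D_v (fun q => complex.Re (g q)) p) ('D_v (fun q => complex.Im (g q)) p).
move=> f1 f2 g1 g2.
case: (f p) (g p) => [a b] [c d] /=.
by apply/eqP; rewrite eq_complex /=; apply/andP; split; apply/eqP;
  rewrite /GRing.scale /=; ring.
Qed.

(** Continuity is known by components, so nonvanishing spreads from whichever of the real and
    imaginary parts is nonzero at [p]. *)
Lemma near_neq0 f p : ccontinuous_at f p -> f p != 0 -> \near p, f p != 0.
Proof.
have op : open [set x : R | x != 0] := @open_neq R 0.
move=> [f1 f2]; have [fp0|fp0] := eqVneq (complex.Re (f p)) 0; last first.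
  have h : \forall q \near p, complex.Re (f q) != 0.
    exact: f1 _ (open_nbhs_nbhs (conj op fp0)).
  move=> _; near=> q; have : complex.Re (f q) != 0 by near: q.
  by apply: contra_neq => ->.
have [gp0|gp0] := eqVneq (complex.Im (f p)) 0.
  by move=> /eqP; case: (f p) fp0 gp0 => a b /= -> ->.
have h : \forall q \near p, complex.Im (f q) != 0.
  exact: f2 _ (open_nbhs_nbhs (conj op gp0)).
move=> _; near=> q; have : complex.Im (f q) != 0 by near: q.
by apply: contra_neq => ->.
Unshelve. all: by end_near. Qed.

Lemma cdifferentiableV f p : cdifferentiable f p -> f p != 0 ->
  cdifferentiable (fun q => (f q)^-1) p.
Proof.
move=> [df1 df2] fp0.
have dn : differentiable
    (fun q => (complex.Re (f q) ^+ 2 + complex.Im (f q) ^+ 2)^-1) p.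
  apply: differentiableV; last by rewrite gt_eqF// sqr_normc_gt0.
  under eq_fun do rewrite !expr2.
  by apply: differentiableD; exact: differentiableM.
split.
  under eq_fun do rewrite complex_ReV.
  exact: differentiableM.
under eq_fun do rewrite complex_ImV.
by apply: differentiableN; exact: differentiableM.
Qed.

(** Follows from the product rule for [f * f^-1], which is constantly 1 near [p]. *)
Lemma cderiveV f v p : cdifferentiable f p -> f p != 0 ->
  cderive (fun q => (f q)^-1) v p = - cderive f v p / f p ^+ 2.
Proof.
move=> df fp0; have dfV := cdifferentiableV df fp0.
have : cderive (fun q => f q * (f q)^-1) v p = 0.
  rewrite -(cderive_cst 1 v p); apply: near_eq_cderive.
  apply: filterS (near_neq0 (cdifferentiable_continuous df) fp0) => q.
  exact: divff.
rewrite cderiveM// => /eqP; rewrite addrC addr_eq0 => /eqP h.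
by apply: (mulfI fp0); rewrite h; field.
Qed.

End ComplexDifferential.

(** * Wirtinger derivatives, both handled at once by a parameter [c] *)

Section Wirtinger.
Context {R : realType}.
Implicit Types (f g h s : R * R -> R[i]) (p v : R * R) (a b c d : R[i]).

Lemma is_diff_fst p : is_diff p (@fst R R) fst.
Proof.
have fc : continuous (@fst R R) by move=> q; exact: cvg_fst.
by apply: DiffDef; [exact: linear_differentiable|rewrite diff_lin].
Qed.

Lemma is_diff_snd p : is_diff p (@snd R R) snd.
Proof.
have fc : continuous (@snd R R) by move=> q; exact: cvg_snd.
by apply: DiffDef; [exact: linear_differentiable|rewrite diff_lin].
Qed.

(* [dxi] and [dxibar] are the cases [c = -i] and [c = i]. *)
Definition has_wderiv c f p d : Prop :=
  cdifferentiable f p /\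
  (cderive f (1, 0) p + c * cderive f (0, 1) p) / 2 = d.

Lemma has_wderiv_dxi f p d :
  has_wderiv (- 'i) f p d <-> cdifferentiable f p /\ dxi f p = d.
Proof. by rewrite /has_wderiv /dxi mulNr. Qed.

Lemma has_wderiv_dxibar f p d :
  has_wderiv 'i f p d <-> cdifferentiable f p /\ dxibar f p = d.
Proof. by []. Qed.

Lemma has_wderiv_eq c f p d e : has_wderiv c f p d -> d = e ->
  has_wderiv c f p e.
Proof. by move=> ? <-. Qed.

Lemma near_eq_has_wderiv c f g p d : (\near p, f p = g p) ->
  has_wderiv c f p d -> has_wderiv c g p d.
Proof.
move=> fg [df <-]; split; first exact: near_eq_cdifferentiable fg df.
by rewrite !(near_eq_cderive _ fg).
Qed.

Lemma has_wderiv_cst c a p : has_wderiv c (fun=> a) p 0.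
Proof.
by split; [exact: cdifferentiable_cst|rewrite !cderive_cst mulr0 addr0 mul0r].
Qed.

Lemma has_wderivD c f g p a b : has_wderiv c f p a -> has_wderiv c g p b ->
  has_wderiv c (fun q => f q + g q) p (a + b).
Proof.
move=> [df <-] [dg <-]; split; first exact: cdifferentiableD.
by rewrite !cderiveD//; ring.
Qed.

Lemma has_wderivM c f g p a b : has_wderiv c f p a -> has_wderiv c g p b ->
  has_wderiv c (fun q => f q * g q) p (a * g p + f p * b).
Proof.
move=> [df <-] [dg <-]; split; first exact: cdifferentiableM.
by rewrite !cderiveM//; ring.
Qed.

Lemma has_wderivMl c k f p a : has_wderiv c f p a ->
  has_wderiv c (fun q => k * f q) p (k * a).
Proof.
by move=> /(has_wderivM (has_wderiv_cst c k p)); rewrite mul0r add0r.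
Qed.

Lemma has_wderivN c f p a : has_wderiv c f p a ->
  has_wderiv c (fun q => - f q) p (- a).
Proof.
move=> /(has_wderivMl (-1)); rewrite mulN1r.
by under eq_fun do rewrite mulN1r.
Qed.

Lemma has_wderivB c f g p a b : has_wderiv c f p a -> has_wderiv c g p b ->
  has_wderiv c (fun q => f q - g q) p (a - b).
Proof. by move=> df /has_wderivN; exact: has_wderivD. Qed.

Lemma has_wderivV c f p a : has_wderiv c f p a -> f p != 0 ->
  has_wderiv c (fun q => (f q)^-1) p (- a / f p ^+ 2).
Proof.
move=> [df <-] fp0; split; first exact: cdifferentiableV.
by rewrite !cderiveV//; field.
Qed.

Lemma has_wderiv_sum c (I : Type) (r : seq I) (F : I -> R * R -> R[i]) p
    (dF : I -> R[i]) : (forall i, has_wderiv c (F i) p (dF i)) ->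
  has_wderiv c (fun q => \sum_(i <- r) F i q) p (\sum_(i <- r) dF i).
Proof.
move=> dFP; elim: r => [|i r IHr].
  by under eq_fun do rewrite big_nil; rewrite big_nil; exact: has_wderiv_cst.
by under eq_fun do rewrite big_cons; rewrite big_cons; exact: has_wderivD.
Qed.

Lemma cderive_xi v p : cderive xi v p = v.1 +i* v.2.
Proof.
have := is_diff_fst p; have := is_diff_snd p => ? ?.
by rewrite /cderive /= !deriveE// !diff_val.
Qed.

Lemma cdifferentiable_xi p : cdifferentiable xi p.
Proof.
by have := is_diff_fst p; have := is_diff_snd p => ? ?; split; exact: ex_diff.
Qed.

Lemma cderive_xibar v p : cderive xibar v p = v.1 -i* v.2.
Proof.
have := is_diff_fst p; have := is_diff_snd p => ? ?.
rewrite /cderive /= deriveN; last exact: diff_derivable.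
by rewrite !deriveE// !diff_val.
Qed.

Lemma cdifferentiable_xibar p : cdifferentiable xibar p.
Proof.
have := is_diff_fst p; have := is_diff_snd p => ? ?; split=> /=.
  exact: ex_diff.
exact/differentiableN/ex_diff.
Qed.

Lemma sqri : 'i ^+ 2 = -1 :> R[i].
Proof.
rewrite expr2; apply/eqP; rewrite eq_complex /=.
by apply/andP; split; apply/eqP; ring.
Qed.

(** The value is 1 for [c = - 'i] and 0 for [c = 'i]; for [xibar] the two are exchanged. *)
Lemma has_wderiv_xi c p : has_wderiv c xi p ((1 + c * 'i) / 2).
Proof. by split; [exact: cdifferentiable_xi|rewrite !cderive_xi]. Qed.

Lemma has_wderiv_xibar c p : has_wderiv c xibar p ((1 - c * 'i) / 2).
Proof.
split; first exact: cdifferentiable_xibar.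
rewrite !cderive_xibar /= oppr0 -mulrN; congr ((_ + c * _) / _).
by apply/eqP; rewrite eq_complex /= oppr0 !eqxx.
Qed.

End Wirtinger.

(** * Differentiability of a continuous branch of the square root *)

Section SquareRoot.
Context {R : realType}.
Implicit Types (f g h s : R * R -> R[i]) (p v : R * R).

Lemma differentiable_sqrt (V : normedModType R) (f : V -> R) x :
  differentiable f x -> 0 < f x -> differentiable (fun y => Num.sqrt (f y)) x.
Proof.
move=> df fx0; apply: (differentiable_comp df).
apply/derivable1_diffP.
by have [] := is_derive1_sqrt fx0.
Qed.

Lemma ccontinuousMl (k : R[i]) f p :
  ccontinuous_at f p -> ccontinuous_at (fun q => k * f q) p.
Proof.
move=> [f1 f2]; split.
  rewrite (_ : (fun q => _) = fun q =>
    complex.Re k * complex.Re (f q) - complex.Im k * complex.Im (f q)).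
    by apply: cvgB; (apply: cvgM; [exact: cvg_cst|]).
  by apply/funext => q; rewrite complex_ReM.
rewrite (_ : (fun q => _) = fun q =>
  complex.Re k * complex.Im (f q) + complex.Im k * complex.Re (f q)).
  by apply: cvgD; (apply: cvgM; [exact: cvg_cst|]).
by apply/funext => q; rewrite complex_ImM.
Qed.

(* After normalization to [s p = 1], the root has positive real part near [p],
   so it is the principal one, which is explicit in terms of [h]. *)
Lemma cdifferentiable_sqrt_branch s h p : ccontinuous_at s p -> s p != 0 ->
  (\near p, s p ^+ 2 = h p) -> cdifferentiable h p -> cdifferentiable s p.
Proof.
move=> sc sp0 s2 dh.
pose y q := (s p)^-1 * s q; pose z q := (s p)^-1 ^+ 2 * h q.
have yc : ccontinuous_at y p := ccontinuousMl (s p)^-1 sc.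
have [dz1 dz2] : cdifferentiable z p.
  by apply: cdifferentiableM => //; exact: cdifferentiable_cst.
have yp : y p = 1 by rewrite /y mulVf.
have zp : z p = 1.
  by rewrite /z -(nbhs_singleton s2) exprVn mulVf// expf_neq0.
have y2 : \near p, y p ^+ 2 = z p.
  by apply: filterS s2 => q sq; rewrite /y /z exprMn sq.
(* This selects the branch: [y] is continuous at [p] with value 1, so its real part stays positive
   nearby. *)
have y0 : \forall q \near p, 0 < complex.Re (y q).
  have := yc.1 _ (open_nbhs_nbhs (conj (@open_gt R 0) _)); apply.
  by rewrite yp /= ltr01.
(* [rho] is the modulus of [z], and [a] is the real part of the principal root of [z]; the imaginary
   part is then [Im z / (2 a)]. *)
pose rho q := Num.sqrt (complex.Re (z q) ^+ 2 + complex.Im (z q) ^+ 2).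
pose a q := Num.sqrt ((rho q + complex.Re (z q)) / 2).
have yE : \near p, a p = complex.Re (y p) /\
    complex.Im (z p) / (2 * a p) = complex.Im (y p).
  near=> q.
  have yq : 0 < complex.Re (y q) by near: q.
  have yzq : y q ^+ 2 = z q by near: q.
  (* For [y = c + i d], the modulus of [y ^+ 2] is [c ^+ 2 + d ^+ 2] and its real part is
     [c ^+ 2 - d ^+ 2]. The half-sum is [c ^+ 2], whose root is [c] because [c > 0]. *)
  rewrite /a /rho -yzq; case: (y q) yq => c d /= c0.
  have -> : (c * c - d * d) ^+ 2 + (c * d + d * c) ^+ 2 =
      (c ^+ 2 + d ^+ 2) ^+ 2 by ring.
  rewrite sqrtr_sqr ger0_norm ?addr_ge0 ?sqr_ge0//.
  have -> : (c ^+ 2 + d ^+ 2 + (c * c - d * d)) / 2 = c ^+ 2 by field.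
  rewrite sqrtr_sqr gtr0_norm//; split=> //.
  by field; rewrite gt_eqF.
have drho : differentiable rho p.
  apply: differentiable_sqrt; last by rewrite zp /= expr0n expr1n addr0.
  under eq_fun do rewrite !expr2.
  by apply: differentiableD; exact: differentiableM.
(* Since [z p = 1], both nested radicands are positive at [p], where the real square root is
   differentiable. *)
have ap : 0 < (rho p + complex.Re (z p)) / 2.
  by rewrite /rho zp /= expr0n expr1n addr0 sqrtr1 divr_gt0.
have da : differentiable a p.
  apply: differentiable_sqrt => //.
  by apply: differentiableM => //; exact: differentiableD.
have dy : cdifferentiable y p.
  split.
    by apply: near_eq_differentiable da; apply: filterS yE => q [].
  apply: (@near_eq_differentiable _ _ _
    (fun q => complex.Im (z q) / (2 * a q))).
    by apply: filterS yE => q [].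
  apply: differentiableM => //; apply: differentiableV.
    by apply: differentiableM => //; exact: differentiable_cst.
  by rewrite mulf_neq0// gt_eqF// sqrtr_gt0.
have -> : s = fun q => s p * y q by apply/funext => q; rewrite /y mulVKf.
by apply: cdifferentiableM => //; exact: cdifferentiable_cst.
Unshelve. all: by end_near. Qed.

End SquareRoot.

(** * Wirtinger derivatives of matrix-valued functions, entry by entry *)

Section MatrixDifferential.
Context {R : realType}.
Implicit Types (f : R * R -> R[i]) (M N : R * R -> 'M[R[i]]_2) (p : R * R).
Implicit Types (X Y : 'M[R[i]]_2) (c d : R[i]).

Definition has_mwderiv c M p X : Prop :=
  forall a b, has_wderiv c (fun q => M q a b) p (X a b).

Lemma has_mwderiv_mdxi M p X :
  has_mwderiv (- 'i) M p X <-> mdifferentiable M p /\ mdxi M p = X.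
Proof.
split=> [MX|[dM <-] a b]; last by apply/has_wderiv_dxi; rewrite mxE.
split=> [a b|]; first by have /has_wderiv_dxi[] := MX a b.
by apply/matrixP => a b; rewrite mxE; have /has_wderiv_dxi[] := MX a b.
Qed.

Lemma has_mwderiv_mdxibar M p X :
  has_mwderiv 'i M p X <-> mdifferentiable M p /\ mdxibar M p = X.
Proof.
split=> [MX|[dM <-] a b]; last by apply/has_wderiv_dxibar; rewrite mxE.
split=> [a b|]; first by have /has_wderiv_dxibar[] := MX a b.
by apply/matrixP => a b; rewrite mxE; have /has_wderiv_dxibar[] := MX a b.
Qed.

Lemma has_mwderiv_eq c M p X Y :
  has_mwderiv c M p X -> X = Y -> has_mwderiv c M p Y.
Proof. by move=> ? <-. Qed.

Lemma near_eq_has_mwderiv c M N p X : (\near p, M p = N p) ->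
  has_mwderiv c M p X -> has_mwderiv c N p X.
Proof.
move=> MN MX a b; apply: near_eq_has_wderiv (MX a b).
by apply: filterS MN => q ->.
Qed.

Lemma has_mwderivB c M N p X Y : has_mwderiv c M p X -> has_mwderiv c N p Y ->
  has_mwderiv c (fun q => M q - N q) p (X - Y).
Proof.
move=> MX NY a b; under eq_fun do rewrite !mxE.
by rewrite !mxE; exact: has_wderivB.
Qed.

Lemma has_mwderivZ c f M p d X : has_wderiv c f p d -> has_mwderiv c M p X ->
  has_mwderiv c (fun q => f q *: M q) p (d *: M p + f p *: X).
Proof.
move=> fd MX a b; under eq_fun do rewrite mxE.
by rewrite !mxE; exact: has_wderivM.
Qed.

Lemma has_mwderiv_mul c M N p X Y : has_mwderiv c M p X ->
  has_mwderiv c N p Y ->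
  has_mwderiv c (fun q => M q *m N q) p (X *m N p + M p *m Y).
Proof.
move=> MX NY a b; under eq_fun do rewrite mxE.
rewrite !mxE -big_split /=; apply: has_wderiv_sum => k.
exact: has_wderivM.
Qed.

Lemma has_mwderiv_sum c (I : Type) (r : seq I) (F : I -> R * R -> 'M[R[i]]_2) p
    (dF : I -> 'M[R[i]]_2) : (forall i, has_mwderiv c (F i) p (dF i)) ->
  has_mwderiv c (fun q => \sum_(i <- r) F i q) p (\sum_(i <- r) dF i).
Proof.
move=> dFP a b; under eq_fun do rewrite summxE.
by rewrite summxE; apply: has_wderiv_sum => i; exact: dFP.
Qed.

Lemma has_mwderiv_mxcomm c M N p X Y : has_mwderiv c M p X ->
  has_mwderiv c N p Y ->
  has_mwderiv c (fun q => mxcomm (M q) (N q)) p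
    (mxcomm X (N p) + mxcomm (M p) Y).
Proof.
move=> MX NY.
have -> : mxcomm X (N p) + mxcomm (M p) Y =
    (X *m N p + M p *m Y) - (Y *m M p + N p *m X).
  by rewrite /mxcomm opprD [- _ - _]addrC addrACA.
by apply: has_mwderivB; exact: has_mwderiv_mul.
Qed.

End MatrixDifferential.

(** * Derivatives of [gamma] and of the coefficients [u] and [v] *)

Section Gamma.
Context {R : realType}.
Implicit Types (s h : R * R -> R[i]) (p : R * R) (w c d : R[i]).

(** Once [s] is differentiable, the product rule for [s * s], which equals [h] near [p], yields
    [2 * s p] times the derivative. *)
Lemma has_wderiv_sqrt_branch c s h p d : ccontinuous_at s p -> s p != 0 ->
  (\near p, s p ^+ 2 = h p) -> has_wderiv c h p d ->
  has_wderiv c s p (d / (2 * s p)).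
Proof.
move=> sc sp0 s2 hd; have ds := cdifferentiable_sqrt_branch sc sp0 s2 hd.1.
split=> //; set e := (X in X = _).
have /has_wderivM/(_ (_ : has_wderiv c s p e)) : has_wderiv c s p e by [].
move=> /(_ (conj ds erefl)) [_ s2e].
have [_] : has_wderiv c (fun q => s q * s q) p d.
  apply: near_eq_has_wderiv hd; apply: filterS s2 => q <-.
  by rewrite expr2.
by rewrite s2e => <-; field.
Qed.

(** The difference is [2 i rho]. *)
Lemma xi_xibar_neq0 p : 0 < p.2 -> xi p - xibar p != 0.
Proof.
move=> p0; rewrite eq_complex /= negb_and; apply/orP; right.
by rewrite opprK gt_eqF// addr_gt0.
Qed.

Variables (w : R[i]) (D : set (R * R)) (s : R * R -> R[i]).
Hypotheses (D_open : open D) (D_upper : forall p, D p -> 0 < p.2).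
Hypothesis s_branch : sqrt_branch w D s.
Let gam := gamma w s.

Section AtPoint.
Variable p : R * R.
Hypothesis Dp : D p.

Let near_D : \near p, D p.
Proof. exact: open_nbhs_nbhs. Qed.

Let a0 : w - xi p != 0.
Proof. by have [/eqP] := s_branch Dp; rewrite subr_eq0. Qed.

Let b0 : w - xibar p != 0.
Proof. by have [_ /eqP] := s_branch Dp; rewrite subr_eq0. Qed.

Let sE : s p ^+ 2 = (w - xi p) * (w - xibar p).
Proof. by have [] := s_branch Dp. Qed.

Let s0 : s p != 0.
Proof. by rewrite -sqrf_eq0 sE mulf_neq0. Qed.

Let t0 : xi p - xibar p != 0.
Proof. exact/xi_xibar_neq0/D_upper. Qed.

(** Eliminating [xibar] solves the quadratic relation rationally in [w], [xi] and [s]. These are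
    then treated as independent, so that [field] applies. *)
Let xibarE : xibar p = w - s p ^+ 2 / (w - xi p).
Proof. by rewrite sE; field. Qed.

(** If [s = - (w - xi)], then [s ^+ 2 = (w - xi) ^+ 2] forces [xibar = xi]. *)
Let as0 : s p + (w - xi p) != 0.
Proof.
apply: contra_neq t0 => /eqP; rewrite addr_eq0 => /eqP sa.
by rewrite xibarE sa; field.
Qed.

Let bs0 : s p + (w - xibar p) != 0.
Proof.
have -> : s p + (w - xibar p) = s p * (s p + (w - xi p)) / (w - xi p).
  by rewrite xibarE; field.
by rewrite !mulf_neq0// invr_eq0.
Qed.

(** This factorization and the next reduce [gamma <> 1] and [gamma <> -1] to [as0] and [bs0]. *)
Let subr1_gamma : 1 - gam p = - 2 * (s p + (w - xi p)) / (xi p - xibar p).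
Proof. by rewrite /gam /gamma; field. Qed.

Let addr1_gamma : 1 + gam p = 2 * (s p + (w - xibar p)) / (xi p - xibar p).
Proof. by rewrite /gam /gamma; field. Qed.

Lemma gamma_neq1 : 1 - gam p != 0.
Proof.
by rewrite subr1_gamma !mulf_neq0 ?invr_eq0// oppr_eq0 pnatr_eq0.
Qed.

Lemma gamma_neqN1 : 1 + gam p != 0.
Proof. by rewrite addr1_gamma !mulf_neq0 ?invr_eq0// pnatr_eq0. Qed.

Let has_wderiv_s c : has_wderiv c s p
  (- ((1 + c * 'i) / 2 * (w - xibar p) + (1 - c * 'i) / 2 * (w - xi p)) /
   (2 * s p)).
Proof.
have [_ _ sc _] := s_branch Dp.
apply: (@has_wderiv_sqrt_branch _ _
  (fun q => (w - xi q) * (w - xibar q))) => //.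
  by apply: filterS near_D => q Dq; have [] := s_branch Dq.
apply: (has_wderiv_eq (has_wderivM
  (has_wderivB (has_wderiv_cst c w p) (has_wderiv_xi c p))
  (has_wderivB (has_wderiv_cst c w p) (has_wderiv_xibar c p)))).
by ring.
Qed.

(** Here [x] and [y] are the derivatives of [xi] and [xibar]. One computation serves both
    directions, with [(x, y)] equal to [(1, 0)] or [(0, 1)]. *)
Let has_wderiv_gamma c (x y : R[i]) :
  (1 + c * 'i) / 2 = x -> (1 - c * 'i) / 2 = y ->
  has_wderiv c gam p
  (- 2 * (x - y) / (xi p - xibar p) ^+ 2 * (w - (xi p + xibar p) / 2 + s p) +
   2 / (xi p - xibar p) * (- (x + y) / 2 -
     (x * (w - xibar p) + y * (w - xi p)) / (2 * s p))).
Proof.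
move=> xE yE.
have dxi := has_wderiv_xi c p; have dxibar := has_wderiv_xibar c p.
have := has_wderiv_s c; rewrite ?xE ?yE in dxi dxibar * => ds.
apply: (has_wderiv_eq (has_wderivM
  (has_wderivMl 2 (has_wderivV (has_wderivB dxi dxibar) t0))
  (has_wderivD (has_wderivB (has_wderiv_cst c w p)
     (has_wderivM (has_wderivD dxi dxibar) (has_wderiv_cst c 2^-1 p))) ds))).
by field; rewrite s0 t0.
Qed.

Lemma has_wderiv_gamma_xi : has_wderiv (- 'i) gam p
  (gam p / (xi p - xibar p) * ((1 + gam p) / (1 - gam p))).
Proof.
have ii : - 'i * 'i = 1 :> R[i] by rewrite mulNr -expr2 sqri opprK.
have := @has_wderiv_gamma (- 'i) 1 0; rewrite ii subrr mul0r.
rewrite -[1 + 1]/(2%:R) divff ?pnatr_eq0// => /(_ erefl erefl) dgam.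
apply: (has_wderiv_eq dgam); rewrite subr1_gamma addr1_gamma /gam /gamma.
move: t0 as0 bs0; rewrite xibarE; move: a0 s0; move: (xi p) (s p) => x y.
move=> xn0 yn0 tn0 asn0 _.
(* This is [(xi - xibar) * (w - xi)] with [xibar] eliminated, the form in which [field] asks for a
   nonzero denominator. *)
have tn0' : x * (w - x) - (w * (w - x) - y ^+ 2) != 0.
  have -> : x * (w - x) - (w * (w - x) - y ^+ 2) =
      (x - (w - y ^+ 2 / (w - x))) * (w - x) by field.
  exact: mulf_neq0.
by field; rewrite xn0 yn0 tn0' asn0.
Qed.

Lemma has_wderiv_gamma_xibar : has_wderiv 'i gam p
  (gam p / (xibar p - xi p) * ((1 - gam p) / (1 + gam p))).
Proof.
have ii : 'i * 'i = - 1 :> R[i] by rewrite -expr2 sqri.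
have := @has_wderiv_gamma 'i 0 1; rewrite ii subrr mul0r opprK.
rewrite -[1 + 1]/(2%:R) divff ?pnatr_eq0// => /(_ erefl erefl) dgam.
apply: (has_wderiv_eq dgam); rewrite subr1_gamma addr1_gamma /gam /gamma.
move: t0 as0 bs0; rewrite xibarE; move: a0 s0; move: (xi p) (s p) => x y.
move=> xn0 yn0 tn0 asn0 _.
have tn0' : x * (w - x) - (w * (w - x) - y ^+ 2) != 0.
  have -> : x * (w - x) - (w * (w - x) - y ^+ 2) =
      (x - (w - y ^+ 2 / (w - x))) * (w - x) by field.
  exact: mulf_neq0.
have t0n' : w * (w - x) - y ^+ 2 + - x * (w - x) != 0.
  by rewrite mulNr -oppr_eq0 opprB.
(* Likewise this is [(s + (w - xibar)) * (w - xi)], which equals [s * (s + (w - xi))]. *)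
have bsn0 : y * (w - x) + (w * (w - x) - (w * (w - x) - y ^+ 2)) != 0.
  by rewrite subKr addrC expr2 -mulrDr mulf_neq0.
by field; rewrite xn0 yn0 tn0' t0n' bsn0.
Qed.

(** One factor [1 - gamma] cancels against the equation for [gamma], leaving
    [- gamma / (t (1 - gamma) (1 + gamma))]; and [u - v = 2 gamma / ((1 - gamma) (1 + gamma))]. The
    lemma for [v] gives the same value by symmetry. *)
Lemma has_wderiv_inv_subr1_gamma :
  has_wderiv 'i (fun q => (1 - gam q)^-1) p
    (- ((1 - gam p)^-1 - (1 + gam p)^-1) / (2 * (xi p - xibar p))).
Proof.
apply: (has_wderiv_eq (has_wderivV (has_wderivB (has_wderiv_cst 'i 1 p)
  has_wderiv_gamma_xibar) gamma_neq1)).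
have t0' : xibar p - xi p != 0 by rewrite -oppr_eq0 opprB.
by field; rewrite t0 t0' gamma_neq1 gamma_neqN1.
Qed.

Lemma has_wderiv_inv_addr1_gamma :
  has_wderiv (- 'i) (fun q => (1 + gam q)^-1) p
    (- ((1 - gam p)^-1 - (1 + gam p)^-1) / (2 * (xi p - xibar p))).
Proof.
apply: (has_wderiv_eq (has_wderivV (has_wderivD (has_wderiv_cst (- 'i) 1 p)
  has_wderiv_gamma_xi) gamma_neqN1)).
by field; rewrite t0 gamma_neq1 gamma_neqN1.
Qed.

End AtPoint.
End Gamma.

(** * Linear identities behind the three integrability statements *)

Section MatrixIdentities.
Context {F : numFieldType} {m n : nat}.
Implicit Types (P Q G H : 'M[F]_(m, n)) (t y : F).

(** The coefficients of [P] and [Q] agree outright, those of [G] and [H] by [2 u v = u + v]. *)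
Lemma deform_mixed_eq y t P Q G H : 1 - y != 0 -> 1 + y != 0 -> t != 0 ->
  let u := (1 - y)^-1 in let v := (1 + y)^-1 in
  - (u - v) / (2 * t) *: P +
    u *: ((2 * t)^-1 *: (P - Q) + 2^-1 *: (H - G) + v *: G) =
  - (u - v) / (2 * t) *: Q +
    v *: ((2 * t)^-1 *: (P - Q) + 2^-1 *: (G - H) + u *: H).
Proof.
move=> u0 v0 t0 u v; apply/matrixP => a b; rewrite !mxE /u /v.
by field; rewrite u0 v0 t0.
Qed.

(** Used with [P = (U - V) / (2 t)], [G = U V] and [H = V U]; both sides are [P + (G + H) / 2]. *)
Lemma linear_mixed_eq P G H :
  P + 2^-1 *: (H - G) + G = P + 2^-1 *: (G - H) + H.
Proof. by apply/matrixP => a b; rewrite !mxE; field. Qed.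

(** Used with [P = U], [Q = V] and [G = [U, V]]. The factors [- 1] and [1] are the derivatives of
    [t] along [xibar] and [xi]. *)
Lemma ernst_eq t P Q G : t != 0 ->
  - 1 *: P + t *: ((2 * t)^-1 *: (P - Q) + 2^-1 *: - G) +
  (1 *: Q + t *: ((2 * t)^-1 *: (P - Q) + 2^-1 *: G)) = 0.
Proof. by move=> t0; apply/matrixP => a b; rewrite !mxE; field. Qed.

End MatrixIdentities.

(** * Algebra of the matrix commutator *)

Section Commutator.
Context {R : realType}.
Implicit Types (A B C : 'M[R[i]]_2) (c : R[i]).

Lemma mxcommZl c A B : mxcomm (c *: A) B = c *: mxcomm A B.
Proof. by rewrite /mxcomm -scalemxAl -scalemxAr scalerBr. Qed.

Lemma mxcommZr c A B : mxcomm A (c *: B) = c *: mxcomm A B.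
Proof. by rewrite /mxcomm -scalemxAl -scalemxAr scalerBr. Qed.

Lemma mxcommDl A B C : mxcomm (A + B) C = mxcomm A C + mxcomm B C.
Proof. by rewrite /mxcomm mulmxDl mulmxDr opprD addrACA. Qed.

Lemma mxcommBl A B C : mxcomm (A - B) C = mxcomm A C - mxcomm B C.
Proof. by rewrite mxcommDl -scaleN1r mxcommZl scaleN1r. Qed.

Lemma mxcommC A B : mxcomm A B = - mxcomm B A.
Proof. by rewrite /mxcomm opprB. Qed.

Lemma mxcommxx A : mxcomm A A = 0.
Proof. by rewrite /mxcomm subrr. Qed.

Lemma mxcommDr A B C : mxcomm A (B + C) = mxcomm A B + mxcomm A C.
Proof. by rewrite mxcommC mxcommDl opprD -!(mxcommC A). Qed.

Lemma mxcommBr A B C : mxcomm A (B - C) = mxcomm A B - mxcomm A C.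
Proof. by rewrite mxcommDr -scaleN1r mxcommZr scaleN1r. Qed.

Lemma mxcomm_suml (I : Type) (r : seq I) (P : pred I) (F : I -> 'M[R[i]]_2) B :
  mxcomm (\sum_(i <- r | P i) F i) B = \sum_(i <- r | P i) mxcomm (F i) B.
Proof. by rewrite /mxcomm mulmx_suml mulmx_sumr -sumrB. Qed.

Lemma mxcomm_sumr (I : Type) (r : seq I) (P : pred I) (F : I -> 'M[R[i]]_2) B :
  mxcomm B (\sum_(i <- r | P i) F i) = \sum_(i <- r | P i) mxcomm B (F i).
Proof. by rewrite /mxcomm mulmx_suml mulmx_sumr -sumrB. Qed.

(** In this form the Jacobi identity turns a commutator acting on [C] into iterated actions of [A]
    and [B]. *)
Lemma mxcomm_Jacobi A B C :
  mxcomm (mxcomm A B) C = mxcomm A (mxcomm B C) - mxcomm B (mxcomm A C).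
Proof.
rewrite /mxcomm !mulmxBl !mulmxBr !mulmxA.
(* The six triple products become independent variables. *)
move: (A *m B *m C) (B *m A *m C) (C *m A *m B) (C *m B *m A) => w x y z.
move: (A *m C *m B) (B *m C *m A) => u v.
by apply/matrixP => i j; rewrite !mxE; ring.
Qed.

(** The sides are the mixed derivatives of [A_j] given by the Leibniz rule. After Jacobi this is
    [deform_mixed_eq] with [P = [U, A]], [Q = [V, A]], [G = [U, [V, A]]] and [H = [V, [U, A]]]. *)
Lemma deform_mixed_mxcomm_eq (y t : R[i]) (U V A : 'M[R[i]]_2) :
  1 - y != 0 -> 1 + y != 0 -> t != 0 ->
  let u := (1 - y)^-1 in let v := (1 + y)^-1 in
  - (u - v) / (2 * t) *: mxcomm U A +
    u *: (mxcomm ((2 * t)^-1 *: (U - V) + 2^-1 *: mxcomm V U) A +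
          mxcomm U (v *: mxcomm V A)) =
  - (u - v) / (2 * t) *: mxcomm V A +
    v *: (mxcomm ((2 * t)^-1 *: (U - V) + 2^-1 *: mxcomm U V) A +
          mxcomm V (u *: mxcomm U A)).
Proof.
move=> u0 v0 t0 u v.
rewrite !mxcommDl !mxcommZl !mxcommZr mxcommBl !mxcomm_Jacobi.
exact: deform_mixed_eq.
Qed.

End Commutator.

(** * Derivatives of [U] and [V], compatibility and the Ernst equation *)

Section LaxPair.
Context {R : realType} {N : nat}.
Variables (w : 'I_N -> R[i]) (D : set (R * R)) (s : 'I_N -> R * R -> R[i]).
Hypotheses (D_open : open D) (D_upper : forall p, D p -> 0 < p.2).
Hypothesis s_branch : forall j, sqrt_branch (w j) D (s j).
Implicit Types (A : 'I_N -> R * R -> 'M[R[i]]_2) (p q : R * R).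

Let gam j := gamma (w j) (s j).

(** The omitted term [k = j] may be restored because [[A_j, A_j] = 0]; the factor [u_j] then comes
    out of the sum. *)
Lemma deform_xiE A j p : deform_xi gam j p (A ^~ p) =
  (1 - gam j p)^-1 *: mxcomm (conn_xi gam A p) (A j p).
Proof.
rewrite /deform_xi /conn_xi mxcommZl.
rewrite [RHS]scalerA [in RHS]mulrC -[RHS]scalerA; congr (_ *: _).
rewrite mxcomm_suml scaler_sumr [RHS](bigD1 j)//= mxcommZl mxcommxx !scaler0.
rewrite add0r; apply: eq_bigr => k _.
by rewrite mxcommZl scalerA invfM mulrC.
Qed.

Lemma deform_xibarE A j p : deform_xibar gam j p (A ^~ p) =
  (1 + gam j p)^-1 *: mxcomm (conn_xibar gam A p) (A j p).
Proof.
rewrite /deform_xibar /conn_xibar mxcommZl.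
rewrite [RHS]scalerA [in RHS]mulrC -[RHS]scalerA; congr (_ *: _).
rewrite mxcomm_suml scaler_sumr [RHS](bigD1 j)//= mxcommZl mxcommxx !scaler0.
rewrite add0r; apply: eq_bigr => k _.
by rewrite mxcommZl scalerA invfM mulrC.
Qed.

Section AtPoint.
Variables (p : R * R) (A : 'I_N -> R * R -> 'M[R[i]]_2).
Hypotheses (Dp : D p) (A_eq : deform_eq_at gam A p).

Let t := xi p - xibar p.
Let U := conn_xi gam A p.
Let V := conn_xibar gam A p.
Let u j := (1 - gam j p)^-1.
Let v j := (1 + gam j p)^-1.

Let t0 : t != 0.
Proof. exact/xi_xibar_neq0/D_upper. Qed.

Lemma has_mwderiv_deform_xi j :
  has_mwderiv (- 'i) (A j) p (u j *: mxcomm U (A j p)).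
Proof.
have [dA xiE _] := A_eq j; apply/has_mwderiv_mdxi; split=> //.
by rewrite xiE deform_xiE.
Qed.

Lemma has_mwderiv_deform_xibar j :
  has_mwderiv 'i (A j) p (v j *: mxcomm V (A j p)).
Proof.
have [dA _ xibarE] := A_eq j; apply/has_mwderiv_mdxibar; split=> //.
by rewrite xibarE deform_xibarE.
Qed.

Let t0' : xibar p - xi p != 0.
Proof. by rewrite -oppr_eq0 opprB. Qed.

Let subUV : U - V = (2 / t) *: \sum_(j < N) (u j + v j) *: A j p.
Proof.
rewrite /U /V /conn_xi /conn_xibar -[xibar p - xi p]opprB invrN mulrN scaleNr.
rewrite opprK -scalerDr -big_split; congr (_ *: _).
by apply: eq_bigr => j _; rewrite scalerDl.
Qed.

(** Writing [[V, U] = [V, U - V]] produces the weights [u_j + v_j = 2 u_j v_j], which also arise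
    from differentiating the [A_j]. *)
Let mxcommVU :
  mxcomm V U = (2 / t) *: \sum_(j < N) (u j + v j) *: mxcomm V (A j p).
Proof.
have -> : mxcomm V U = mxcomm V (U - V) by rewrite mxcommBr mxcommxx subr0.
rewrite subUV mxcommZr mxcomm_sumr; congr (_ *: _).
by apply: eq_bigr => j _; rewrite mxcommZr.
Qed.

Let mxcommUV : mxcomm U V =
  - ((2 / t) *: \sum_(j < N) (u j + v j) *: mxcomm U (A j p)).
Proof.
have -> : mxcomm U V = - mxcomm U (U - V).
  by rewrite mxcommBr mxcommxx sub0r opprK.
rewrite subUV mxcommZr mxcomm_sumr; congr (- (_ *: _)).
by apply: eq_bigr => j _; rewrite mxcommZr.
Qed.

(** Coefficients are compared for each [j]: that of [A_j] is [2 u_j / t ^+ 2 - (u_j - v_j) / t ^+ 2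
    = (u_j + v_j) / t ^+ 2], and that of [[V, A_j]] is [2 u_j v_j / t]. *)
Lemma has_mwderiv_conn_xi :
  has_mwderiv 'i (conn_xi gam A) p
    ((2 * t)^-1 *: (U - V) + 2^-1 *: mxcomm V U).
Proof.
have dt : has_wderiv 'i (fun q => 2 / (xi q - xibar q)) p (2 / t ^+ 2).
  apply: (has_wderiv_eq (has_wderivMl 2 (has_wderivV (has_wderivB
    (has_wderiv_xi 'i p) (has_wderiv_xibar 'i p)) t0))).
  by rewrite /t -expr2 sqri; field; rewrite t0.
have dS := has_mwderivZ dt (has_mwderiv_sum (index_enum 'I_N) (fun j =>
  has_mwderivZ
    (has_wderiv_inv_subr1_gamma D_open D_upper (@s_branch j) Dp)
    (has_mwderiv_deform_xibar j))).
rewrite subUV mxcommVU.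
apply: (has_mwderiv_eq dS); rewrite !scaler_sumr -!big_split.
apply: eq_bigr => j _ /=.
have u0 := gamma_neq1 D_upper (@s_branch j) Dp.
have v0 := gamma_neqN1 D_upper (@s_branch j) Dp.
move: t0 u0 v0; rewrite /u /v /gam /t.
move: (xi p - xibar p) (gamma _ _ p) (A j p) (mxcomm _ _) => z y a B.
move=> z0 u0 v0; rewrite !scalerDr !scalerA addrA -scalerDl.
by congr (_ *: _ + _ *: _); field; rewrite z0 u0 v0.
Qed.

Lemma has_mwderiv_conn_xibar :
  has_mwderiv (- 'i) (conn_xibar gam A) p
    ((2 * t)^-1 *: (U - V) + 2^-1 *: mxcomm U V).
Proof.
have ii : - 'i * 'i = 1 :> R[i] by rewrite mulNr -expr2 sqri opprK.
have dt : has_wderiv (- 'i) (fun q => 2 / (xibar q - xi q)) p (2 / t ^+ 2).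
  apply: (has_wderiv_eq (has_wderivMl 2 (has_wderivV (has_wderivB
    (has_wderiv_xibar (- 'i) p) (has_wderiv_xi (- 'i) p)) t0'))).
  by rewrite ii /t; field; rewrite t0 t0'.
have dS := has_mwderivZ dt (has_mwderiv_sum (index_enum 'I_N) (fun j =>
  has_mwderivZ
    (has_wderiv_inv_addr1_gamma D_open D_upper (@s_branch j) Dp)
    (has_mwderiv_deform_xi j))).
rewrite subUV mxcommUV scalerN -scaleNr.
apply: (has_mwderiv_eq dS); rewrite !scaler_sumr -!big_split.
apply: eq_bigr => j _ /=.
have u0 := gamma_neq1 D_upper (@s_branch j) Dp.
have v0 := gamma_neqN1 D_upper (@s_branch j) Dp.
move: t0 u0 v0; rewrite /u /v /gam /t -[xibar p - xi p]opprB.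
move: (xi p - xibar p) (gamma _ _ p) (A j p) (mxcomm _ _) => z y a B.
move=> z0 u0 v0; rewrite !scalerDr !scalerA addrA -scalerDl.
by congr (_ *: _ + _ *: _); field; rewrite ?oppr_eq0 z0 u0 v0.
Qed.

Lemma deform_compatible_at j :
  exists X, has_mwderiv 'i (fun q => deform_xi gam j q (A ^~ q)) p X /\
    has_mwderiv (- 'i) (fun q => deform_xibar gam j q (A ^~ q)) p X.
Proof.
have dxi := has_mwderivZ
  (has_wderiv_inv_subr1_gamma D_open D_upper (@s_branch j) Dp)
  (has_mwderiv_mxcomm has_mwderiv_conn_xi (has_mwderiv_deform_xibar j)).
have dxibar := has_mwderivZ
  (has_wderiv_inv_addr1_gamma D_open D_upper (@s_branch j) Dp)
  (has_mwderiv_mxcomm has_mwderiv_conn_xibar (has_mwderiv_deform_xi j)).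
(* These factorizations hold at every point for any [A], so they may be used under the derivative
   although the equations are assumed at [p] alone. *)
rewrite (funext (deform_xiE A j)) (funext (deform_xibarE A j)).
eexists; split; first exact: dxi.
apply: (has_mwderiv_eq dxibar).
have u0 := gamma_neq1 D_upper (@s_branch j) Dp.
have v0 := gamma_neqN1 D_upper (@s_branch j) Dp.
exact: esym (deform_mixed_mxcomm_eq U V (A j p) u0 v0 t0).
Qed.

End AtPoint.

Lemma deform_compatible_gamma : deform_compatible D gam.
Proof.
move=> p A Dp A_eq j.
have [X [/has_mwderiv_mdxibar[d1 e1] /has_mwderiv_mdxi[d2 e2]]] :=
  deform_compatible_at Dp A_eq j.
by split=> //; rewrite e1 e2.
Qed.

Lemma linear_compatible_conn A : deform_solution D gam A ->
  linear_compatible D (conn_xi gam A) (conn_xibar gam A).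
Proof.
move=> A_sol p g Dp [g_unit dg gxi gxibar].
have dxi : has_mwderiv (- 'i) g p (conn_xi gam A p *m g p).
  by apply/has_mwderiv_mdxi; rewrite -gxi mulmxKV.
have dxibar : has_mwderiv 'i g p (conn_xibar gam A p *m g p).
  by apply/has_mwderiv_mdxibar; rewrite -gxibar mulmxKV.
have /has_mwderiv_mdxibar[d1 e1] :=
  has_mwderiv_mul (has_mwderiv_conn_xi Dp (A_sol p Dp)) dxibar.
have /has_mwderiv_mdxi[d2 e2] :=
  has_mwderiv_mul (has_mwderiv_conn_xibar Dp (A_sol p Dp)) dxi.
split; [exact: d1|exact: d2|].
rewrite e1 e2.
move: (conn_xi gam A p) (conn_xibar gam A p) (g p) => U V G.
(* Factoring [g] out on the right leaves the zero-curvature identity. *)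
rewrite [U *m (V *m G)]mulmxA [V *m (U *m G)]mulmxA.
rewrite -[LHS]mulmxDl -[RHS]mulmxDl; congr (_ *m G).
exact: linear_mixed_eq.
Qed.

Lemma ernst_equation_conn A g : deform_solution D gam A ->
  linear_solution D (conn_xi gam A) (conn_xibar gam A) g -> ernst_equation D g.
Proof.
move=> A_sol g_sol p Dp.
have near_D : \near p, D p by exact: open_nbhs_nbhs.
have t0 := xi_xibar_neq0 (D_upper Dp).
have dt (c : R[i]) := has_wderivB (has_wderiv_xi c p) (has_wderiv_xibar c p).
(* As [D] is open, the linear system identifies [ernst_xi g] with [t U] near [p], so its derivative
   is obtained without differentiating [g] twice. *)
have xiE : \near p,
    (xi p - xibar p) *: conn_xi gam A p = ernst_xi g p.
  by apply: filterS near_D => q Dq; have [_ _ <- _] := g_sol q Dq.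
have xibarE : \near p,
    (xi p - xibar p) *: conn_xibar gam A p = ernst_xibar g p.
  by apply: filterS near_D => q Dq; have [_ _ _ <-] := g_sol q Dq.
have /has_mwderiv_mdxibar[d1 e1] := near_eq_has_mwderiv xiE
  (has_mwderivZ (dt 'i) (has_mwderiv_conn_xi Dp (A_sol p Dp))).
have /has_mwderiv_mdxi[d2 e2] := near_eq_has_mwderiv xibarE
  (has_mwderivZ (dt (- 'i)) (has_mwderiv_conn_xibar Dp (A_sol p Dp))).
split; [exact: d1|exact: d2|rewrite e1 e2].
have -> : (1 + 'i * 'i) / 2 - (1 - 'i * 'i) / 2 = - 1 :> R[i].
  by rewrite -expr2 sqri; field.
have -> : (1 + - 'i * 'i) / 2 - (1 - - 'i * 'i) / 2 = 1 :> R[i].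
  by rewrite mulNr -expr2 sqri; field.
rewrite [mxcomm (conn_xibar _ _ _) _]mxcommC; exact: ernst_eq.
Qed.

End LaxPair.

Theorem theorem2 (R : realType) (N : nat) (w : 'I_N -> R[i])
    (D : set (R * R)) (s : 'I_N -> R * R -> R[i])
    (D_open : open D) (D_upper : forall p, D p -> 0 < p.2)
    (s_branch : forall j, sqrt_branch (w j) D (s j)) :
  let gam j := gamma (w j) (s j) in
  deform_compatible D gam /\
  (forall A : 'I_N -> R * R -> 'M[R[i]]_2,
     deform_solution D gam A ->
     linear_compatible D (conn_xi gam A) (conn_xibar gam A) /\
     (forall g : R * R -> 'M[R[i]]_2,
        linear_solution D (conn_xi gam A) (conn_xibar gam A) g ->
        ernst_equation D g)).
Proof.
move=> gam; split; first exact: deform_compatible_gamma.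
move=> A A_sol; split; first exact: linear_compatible_conn.
by move=> g g_sol; exact: ernst_equation_conn g_sol.
Qed.
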